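(* Let $\mathbb F_q$ be a finite field of odd characteristic and $V\subset\mathbb F_{q*}^d$ an algebraic variety with $c\,q^{d-1}\le|V|\le C\,q^{d-1}$ (constants $c,C>0$ independent of $q$), with normalized surface measure $d\sigma$. Then: (i) if $d\ge3$ is odd, $R_{rad}\!\left(\frac{2d}{d+1}\to 2\right)\lesssim1$, i.e. there is a constant $C'$ independent of $q$ such that $\|\widehat f\|_{L^2(V,d\sigma)}\le C'\|f\|_{L^{2d/(d+1)}(\mathbb F_q^d,dm)}$ for all radial $f:\mathbb F_q^d\to\mathbb C$; (ii) if $d\ge4$ is even, $R_{rad}\!\left(\frac{2d-2}{d}\to\frac{2(d-1)^2}{d^2-2d}\right)\lesssim1$, i.e. there is a constant $C'$ independent of $q$ such that $\|\widehat f\|_{L^{r}(V,d\sigma)}\le C'\|f\|_{L^{p}(\mathbb F_q^d,dm)}$ with $p=\frac{2d-2}{d}$, $r=\frac{2(d-1)^2}{d^2-2d}$, for all radial $f:\mathbb F_q^d\to\mathbb C$.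
   Context: $\mathbb F_q^d$ carries counting measure $dm$; its dual space $\mathbb F_{q*}^d$ (identified with $\mathbb F_q^d$ as a group) is where $\widehat f$ lives. $\chi$ is a fixed nontrivial additive character of $\mathbb F_q$ and $\widehat f(x)=\sum_{m\in\mathbb F_q^d}\chi(-m\cdot x)f(m)$. So $\|f\|_{L^p(\mathbb F_q^d,dm)}=(\sum_{m}|f(m)|^p)^{1/p}$. The normalized surface measure on $V$ is given by $\int g\,d\sigma=\frac1{|V|}\sum_{x\in V}g(x)$, so $\|\widehat f\|_{L^r(V,d\sigma)}=(\frac1{|V|}\sum_{x\in V}|\widehat f(x)|^r)^{1/r}$. For $m\in\mathbb F_q^d$, $\|m\|=m_1^2+\cdots+m_d^2$; $f$ is radial if $f(m)=f(n)$ whenever $\|m\|=\|n\|$. $R_{rad}(p\to r)\lesssim1$ means the estimate $\|\widehat f\|_{L^r(V,d\sigma)}\le C\|f\|_{L^p(\mathbb F_q^d,dm)}$ holds for all radial $f$ with $C$ independent of $f$ and of $q$. *)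

(* Defs.v *)
From HB Require Import structures.
From mathcomp Require Import all_boot all_order all_algebra all_field.
From Stdlib Require Import Reals.

Set Implicit Arguments.
Unset Strict Implicit.
Unset Printing Implicit Defensive.

Import GRing.Theory.
Local Open Scope ring_scope.

Definition Cpx : Type := (R * R)%type.
Definition C0 : Cpx := (R0, R0).
Definition C1 : Cpx := (R1, R0).
Definition Cadd (z w : Cpx) : Cpx := (Rplus z.1 w.1, Rplus z.2 w.2).
Definition Cmul (z w : Cpx) : Cpx :=
  (Rminus (Rmult z.1 w.1) (Rmult z.2 w.2), Rplus (Rmult z.1 w.2) (Rmult z.2 w.1)).
Definition Cmod (z : Cpx) : R := sqrt (Rplus (Rmult z.1 z.1) (Rmult z.2 z.2)).

(* x^y for x >= 0, y > 0, with 0^y = 0. *)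
Definition rpow (x y : R) : R := if Rlt_dec R0 x then Rpower x y else R0.

(* F_q^d and its dual, both as functions 'I_d -> F. *)
Definition vec (F : finFieldType) (d : nat) := {ffun 'I_d -> F}.
Definition dotp (F : finFieldType) (d : nat) (m x : vec F d) : F :=
  \sum_(i < d) m i * x i.
Definition sqnorm (F : finFieldType) (d : nat) (m : vec F d) : F :=
  \sum_(i < d) m i ^+ 2.

Definition radial (F : finFieldType) (d : nat) (f : vec F d -> Cpx) : Prop :=
  forall m n : vec F d, sqnorm m = sqnorm n -> f m = f n.

Definition nontrivial_additive_char (F : finFieldType) (chi : F -> Cpx) : Prop :=
  (forall a b : F, chi (a + b) = Cmul (chi a) (chi b)) /\ exists a : F, chi a <> C1.

Definition mpoly (F : finFieldType) (d : nat) := seq (F * ('I_d -> nat)).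
Definition meval (F : finFieldType) (d : nat) (P : mpoly F d) (x : vec F d) : F :=
  \sum_(t <- P) t.1 * \prod_(i < d) x i ^+ (t.2 i).

Definition is_variety (F : finFieldType) (d : nat) (V : {set vec F d}) : Prop :=
  exists Ps : seq (mpoly F d),
    forall x : vec F d, (x \in V) = all (fun P => meval P x == 0) Ps.

Definition fourier (F : finFieldType) (d : nat) (chi : F -> Cpx)
    (f : vec F d -> Cpx) (x : vec F d) : Cpx :=
  \big[Cadd/C0]_(m : vec F d) Cmul (chi (- dotp m x)) (f m).

Definition Lp_norm (F : finFieldType) (d : nat) (p : R) (f : vec F d -> Cpx) : R :=
  rpow (\big[Rplus/R0]_(m : vec F d) rpow (Cmod (f m)) p) (Rinv p).

Definition Lsigma_norm (F : finFieldType) (d : nat) (r : R) (V : {set vec F d})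
    (g : vec F d -> Cpx) : R :=
  rpow (Rmult (Rinv (INR #|V|)) (\big[Rplus/R0]_(x in V) rpow (Cmod (g x)) r)) (Rinv r).

Definition Rrad_bounded (d : nat) (c C : R) (p r : R) : Prop :=
  exists C' : R,
    forall (F : finFieldType), ~~ (2%N \in [pchar F]) ->
    forall (V : {set vec F d}), is_variety V ->
      Rle (Rmult c (pow (INR #|F|) (d - 1))) (INR #|V|) ->
      Rle (INR #|V|) (Rmult C (pow (INR #|F|) (d - 1))) ->
    forall (chi : F -> Cpx), nontrivial_additive_char chi ->
    forall (f : vec F d -> Cpx), radial f ->
      Rle (Lsigma_norm r V (fourier chi f)) (Rmult C' (Lp_norm p f)).

(* Main.v *)
Require Import Defs.
From HB Require Import structures.
From Stdlib Require Import Reals.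
From mathcomp Require Import all_boot all_order all_algebra all_field.
From mathcomp Require Import ring lra zify complex Rstruct.

(* For radial [f m = w (|m|)] the transform at [x] is [sum_t w t * S_t^(x)] with
   [S_t] the sphere of radius [t], and for [x <> 0]
   [q * S_t^(x) = sum_(s <> 0) g(s)^d chi(- |x| / (4 s)) chi(- s t)]
   where the Gauss sum [g(s)] has modulus [sqrt q].
   If [d] is odd this is [q^((d-1)/2)] times a Salie sum, which is the transform of
   a one-dimensional sphere, hence [|S_t^(x)| <= 3 q^((d-1)/2)].  As [|S_t|] is of
   order [q^(d-1)], this gives [|f^(x)| << q^(-(d-1)/2) |f|_1], and Hoelder's
   inequality bounds the right-hand side by [|f|_p].
   If [d] is even, Parseval in [t] gives [|f^(x)|^2 <= q^d sum_t |w t|^2], which is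
   [<< |f|_p^2] because [l^p] embeds in [l^2] with constant [1] and
   [(d-1)/p = d/2].
   So [|f^(x)| << |f|_p] off the origin, whereas [|f^(0)| <= |f|_1] has only the
   weight [1 / |V|]; the exponent [r] is the one that makes this weight suffice. *)

Set Implicit Arguments.
Unset Strict Implicit.
Unset Printing Implicit Defensive.

Import Order.TTheory GRing.Theory Num.Theory.
Local Open Scope ring_scope.

(* By default these arguments would be read in [R_scope]. *)
Local Arguments rpow (x y)%_ring_scope.
Local Arguments Rrad_bounded d%_nat_scope (c C p r)%_ring_scope.

(** Doubled, the difference of the two sides is a double sum over [i] and [j]; termwise it is the
    inequality [2 u v <= u^2 + v^2] for [u = a i * b j] and [v = a j * b i]. *)
Lemma cauchy_schwarz_sum (R : numDomainType) (I : finType) (a b : I -> R) :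
  (forall i, 0 <= a i) -> (forall i, 0 <= b i) ->
  (\sum_i a i * b i) ^+ 2 <= (\sum_i a i ^+ 2) * (\sum_i b i ^+ 2).
Proof.
move=> a0 b0; rewrite -(ler_pMn2r (n := 2)) // expr2 !big_distrlr /= [X in _ <= X]mulr2n.
rewrite [X in _ <= _ + X]exchange_big -!sumrMnl -big_split /=.
apply: ler_sum => i _; rewrite -sumrMnl -big_split /=.
apply: ler_sum => j _.
rewrite (_ : a i * b i * (a j * b j) = a i * b j * (a j * b i)); last by ring.
by rewrite -!exprMn real_leif_mean_square_scaled // ger0_real // mulr_ge0.
Qed.

(** * Additive characters and quadratic Gauss sums *)

Section GaussSums.

Variables (C : numClosedFieldType) (F : finFieldType) (chi : F -> C).
Hypothesis two_neq0 : 2%:R != 0 :> F.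
Hypothesis chiD : forall a b, chi (a + b) = chi a * chi b.
Hypothesis chi0 : chi 0 = 1.
Hypothesis chi_nontrivial : exists a, chi a != 1.

Local Notation q := (#|F|%:R : C).

Let q_gt0 : 0 < q.
Proof. by rewrite ltr0n; apply/card_gt0P; exists 0. Qed.

(** If [p] is the characteristic, [chi a] is a [p]-th root of unity because [a *+ p = 0]. *)
Lemma normr_char a : `|chi a| = 1.
Proof.
have [p p_pr pF] := finPcharP F.
apply/eqP; rewrite -(pexpr_eq1 (prime_gt0 p_pr)) // -normrX.
have chiM n : chi a ^+ n = chi (a *+ n).
  by elim: n => [|n IHn]; rewrite ?expr0 ?mulr0n ?chi0 // exprS IHn mulrS chiD.
by rewrite chiM (mulrn_pchar pF) chi0 normr1.
Qed.

Lemma charN a : chi (- a) = (chi a)^*.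
Proof.
have chia0 : chi a != 0 by rewrite -normr_eq0 normr_char oner_eq0.
by apply: (mulfI chia0); rewrite -chiD subrr chi0 -normCK normr_char expr1n.
Qed.

Lemma sum_char c : \sum_a chi (c * a) = if c == 0 then q else 0.
Proof.
case: eqVneq => [->|c0].
  by under eq_bigr do rewrite mul0r chi0; rewrite sumr_const cardT.
have [a chia] := chi_nontrivial.
have: (1 - chi a) * \sum_a chi (c * a) = 0.
  rewrite mulrBl mul1r [X in X - _](reindex_inj (addrI (a / c))) /=.
  rewrite mulr_sumr -sumrB big1 // => b _.
  by rewrite mulrDr mulrCA mulfV // mulr1 chiD subrr.
by move/eqP; rewrite mulf_eq0 subr_eq0 eq_sym (negPf chia) => /eqP.
Qed.

Definition gauss (s : F) : C := \sum_y chi (s * y ^+ 2).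

(** Shifting [y] by [z] in the double sum for [|gauss s|^2] leaves [z] only in the factor
    [chi (s * 2 * y * z)], whose sum over [z] vanishes unless [y = 0]. *)
Lemma normr_gauss s : s != 0 -> `|gauss s| ^+ 2 = q.
Proof.
move=> s0; rewrite normCK rmorph_sum /= mulr_sumr.
transitivity (\sum_z \sum_y chi (s * y ^+ 2) * chi ((s * 2 * y) * z)).
  apply: eq_bigr => z _; rewrite mulr_suml (reindex_inj (addrI z)) /=.
  apply: eq_bigr => y _; rewrite -charN -!chiD; congr chi; ring.
rewrite exchange_big /= (bigD1 0) //= -mulr_sumr sum_char !mulr0 eqxx.
rewrite expr0n mulr0 chi0 mul1r big1 ?addr0 // => y y0.
by rewrite -mulr_sumr sum_char !mulf_eq0 (negPf s0) (negPf y0) (negPf two_neq0) mulr0.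
Qed.

Lemma gauss_sqr s c : c != 0 -> gauss (c ^+ 2 * s) = gauss s.
Proof.
move=> c0; rewrite [RHS](reindex_inj (mulfI c0)) /=.
by apply: eq_bigr => y _; congr chi; ring.
Qed.

Lemma card_sqrt (u : F) : (#|[pred y : F | y ^+ 2 == u]| <= 2)%N.
Proof.
case: (pickP [pred y : F | y ^+ 2 == u]) => [y0 /= /eqP <-|H]; last first.
  by rewrite eq_card0.
apply: leq_trans (subset_leq_card _) (_ : #|[set y0; - y0]| <= 2)%N.
  by apply/subsetP=> y; rewrite !inE eqf_sqr.
by rewrite cards2; case: eqP.
Qed.

Lemma sum_card_fiber (h : F -> F) :
  (\sum_u #|[pred y | h y == u]| = #|F|)%N.
Proof.
rewrite -[RHS]sum1_card [RHS](partition_big h xpredT) //=.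
by apply: eq_bigr => u _; rewrite -sum1_card; apply: eq_bigl => y; rewrite inE.
Qed.

Lemma gauss_fiber (h : F -> F) s :
  \sum_y chi (s * h y) = \sum_u chi (s * u) *+ #|[pred y | h y == u]|.
Proof.
rewrite [LHS](partition_big h xpredT) //=; apply: eq_bigr => u _.
by rewrite -sumr_const; apply: eq_bigr => y /eqP ->.
Qed.

(** Nonzero values of [y ^+ 2] and of [b * y ^+ 2] lie in the two disjoint square classes, so
    together the two maps take each value at most twice. *)
Lemma card_nonsquare_fibers (b u : F) (h := fun y : F => b * y ^+ 2) :
  b != 0 -> (forall c : F, b != c ^+ 2) ->
  (#|[pred y : F | y ^+ 2 == u]| + #|[pred y : F | h y == u]| = 2)%N.
Proof.
move=> b0 bns.
pose N v := (#|[pred y : F | y ^+ 2 == v]| + #|[pred y : F | h y == v]|)%N.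
have N_le2 v : (N v <= 2)%N.
  case: (eqVneq v 0) => [->|v0].
    rewrite /N !(@eq_card _ _ (pred1 (0 : F))) ?card1 // => y; rewrite !inE /h.
      by rewrite mulf_eq0 (negPf b0) sqrf_eq0.
    by rewrite sqrf_eq0.
  case: (pickP [pred y : F | y ^+ 2 == v]) => [y0 /= /eqP y0v|H].
    rewrite /N [X in (_ + X)%N]eq_card0 ?addn0 ?card_sqrt // => y.
    rewrite !inE /h; apply/negP => /eqP yv.
    have y0' : y != 0.
      by apply: contra_neq v0 => y0'; rewrite -yv y0' expr0n mulr0.
    have := bns (y0 / y); rewrite expr_div_n y0v -yv mulfK ?eqxx //.
    by rewrite sqrf_eq0.
  rewrite /N eq_card0 // add0n.
  apply: leq_trans (card_sqrt (v / b)); apply: subset_leq_card.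
  by apply/subsetP => y; rewrite !inE /h => /eqP <-; rewrite mulrAC mulfV ?mul1r.
(* The counts [N v] add up to [2 * #|F|], so the bound [N v <= 2] is attained at every [v]. *)
have eqN : [forall v, N v == 2].
  rewrite -(leqif_sum (fun v (_ : xpredT v) => leqif_eq (N_le2 v))) /=.
  rewrite big_split /= !sum_card_fiber sum_nat_const muln2 addnn.
  by rewrite eqxx.
by have /forallP/(_ u)/eqP := eqN.
Qed.

(** The sign [e] is the quadratic character of [b]. For a nonsquare, the fiber count gives [gauss (b
    * s) + gauss s = 2 * \sum_u chi (s * u) = 0]. *)
Lemma gauss_mul b : b != 0 -> exists e : C,
  e ^+ 2 = 1 /\ forall s, s != 0 -> gauss (b * s) = e * gauss s.
Proof.
move=> b0; case: (pickP [pred c : F | b == c ^+ 2]) => [c /= /eqP bc|bns].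
  exists 1; rewrite expr1n; split=> // s _; rewrite mul1r bc gauss_sqr //.
  by rewrite -sqrf_eq0 -bc.
exists (-1); rewrite sqrrN expr1n; split=> // s s0; rewrite mulN1r.
apply/eqP; rewrite -addr_eq0 addrC; apply/eqP.
have -> : gauss (b * s) = \sum_y chi (s * (b * y ^+ 2)).
  by apply: eq_bigr => y _; congr chi; ring.
rewrite /gauss !gauss_fiber -big_split /=.
under eq_bigr => u _.
  rewrite -mulrnDr card_nonsquare_fibers //; last by move=> c; have /= -> := bns c.
  over.
by rewrite sumrMnl sum_char (negPf s0) mul0rn.
Qed.

(** Completing the square: [y] is shifted by [z / (2 s)]. *)
Lemma sum_char_quad s z : s != 0 ->
  \sum_y chi (s * y ^+ 2 - y * z) = gauss s * chi (- (z ^+ 2 / (4%:R * s))).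
Proof.
move=> s0; have s20 : 2%:R * s != 0 by rewrite mulf_neq0.
have four : 4%:R = 2%:R * 2%:R :> F by rewrite -natrM.
rewrite (reindex_inj (addrI (z / (2%:R * s)))) /= mulr_suml.
apply: eq_bigr => y _; rewrite -chiD; congr chi; field.
by rewrite s0 two_neq0 four mulf_neq0.
Qed.

(** * Fourier transforms of spheres *)

Variable d : nat.
Implicit Types m x : vec F d.

Lemma char_sum I (r : seq I) (P : pred I) (h : I -> F) :
  chi (\sum_(i <- r | P i) h i) = \prod_(i <- r | P i) chi (h i).
Proof. exact: (big_morph chi chiD chi0). Qed.

Lemma sum_vec_prod (h : 'I_d -> F -> C) :
  \sum_(m : vec F d) \prod_i h i (m i) = \prod_i \sum_y h i y.
Proof. by rewrite bigA_distr_bigA. Qed.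

Lemma sum_vec_char_quad s x : s != 0 ->
  \sum_m chi (s * sqnorm m - dotp m x) =
  gauss s ^+ d * chi (- (sqnorm x / (4%:R * s))).
Proof.
move=> s0; rewrite /sqnorm /dotp.
under eq_bigr do rewrite mulr_sumr -sumrB char_sum.
rewrite (sum_vec_prod (fun i y => chi (s * y ^+ 2 - y * x i))).
under eq_bigr do rewrite sum_char_quad //.
rewrite big_split /= prodr_const card_ord; congr (_ * _).
by rewrite mulr_suml -sumrN char_sum.
Qed.

Lemma sum_vec_char x :
  \sum_m chi (- dotp m x) = if x == 0 then q ^+ d else 0.
Proof.
rewrite /dotp; under eq_bigr do rewrite -sumrN char_sum.
rewrite (sum_vec_prod (fun i y => chi (- (y * x i)))).
have sumE i : \sum_y chi (- (y * x i)) = if x i == 0 then q else 0.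
  by under eq_bigr do rewrite mulrC -mulNr; rewrite sum_char oppr_eq0.
under eq_bigr do rewrite sumE.
case: eqVneq => [->|x0].
  under eq_bigr do rewrite ffunE eqxx.
  by rewrite prodr_const card_ord.
have [i xi0] : exists i, x i != 0.
  apply/existsP; apply: contra_neqT x0; rewrite negb_exists => /forallP H.
  by apply/ffunP => i; rewrite ffunE; apply/eqP; rewrite -[_ == _]negbK H.
by rewrite (bigD1 i) //= (negPf xi0) mul0r.
Qed.

Definition sphere_hat t x : C := \sum_(m | sqnorm m == t) chi (- dotp m x).

(** The condition [sqnorm m = t] is detected by orthogonality in a new variable [s]; the term
    [s = 0] is the isolated one, and the others are Gaussian sums over the whole space. *)
Lemma sphere_hatE t x :
  q * sphere_hat t x = (if x == 0 then q ^+ d else 0) +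
    \sum_(s | s != 0) gauss s ^+ d * chi (- (sqnorm x / (4%:R * s))) * chi (- (s * t)).
Proof.
transitivity (\sum_s \sum_m chi (s * sqnorm m - dotp m x) * chi (- (s * t))).
  rewrite exchange_big mulr_sumr big_mkcond /=; apply: eq_bigr => m _.
  transitivity (chi (- dotp m x) * \sum_s chi ((sqnorm m - t) * s)).
    by rewrite sum_char subr_eq0; case: ifP => _; rewrite ?mulr0 // mulrC.
  rewrite mulr_sumr; apply: eq_bigr => s _; rewrite -!chiD; congr chi; ring.
rewrite (bigD1 0) //=; congr (_ + _).
  rewrite -sum_vec_char; apply: eq_bigr => m _.
  by rewrite !mul0r oppr0 chi0 mulr1 sub0r.
by apply: eq_bigr => s s0; rewrite -mulr_suml sum_vec_char_quad.
Qed.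

(* The left-hand side is [q] times the Fourier transform of the
   "sphere" [n * y ^+ 2 = t] of the line, which has at most two points. *)
Lemma salie_bound n z t : n != 0 ->
  `|\sum_(s | s != 0) gauss (n * s) * chi (- (z ^+ 2 / n / (4%:R * s))) *
      chi (- (s * t))| <= 3%:R * q.
Proof.
move=> n0.
(* Over all [s] the sum detects [n * y ^+ 2 = t]; the subtracted sum over [y] is the term
   [s = 0]. *)
have -> : \sum_(s | s != 0) gauss (n * s) * chi (- (z ^+ 2 / n / (4%:R * s))) *
      chi (- (s * t)) =
    q * \sum_(y | n * y ^+ 2 == t) chi (- (y * z)) - \sum_y chi (- (y * z)).
  apply/eqP; rewrite eq_sym subr_eq addrC; apply/eqP.
  transitivity (\sum_s \sum_y chi (n * s * y ^+ 2 - y * z) * chi (- (s * t))).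
    rewrite exchange_big mulr_sumr big_mkcond /=; apply: eq_bigr => y _.
    transitivity (chi (- (y * z)) * \sum_s chi ((n * y ^+ 2 - t) * s)).
      by rewrite sum_char subr_eq0; case: ifP => _; rewrite ?mulr0 // mulrC.
    rewrite mulr_sumr; apply: eq_bigr => s _; rewrite -!chiD; congr chi; ring.
  rewrite (bigD1 0) //=; congr (_ + _).
    by apply: eq_bigr => y _; rewrite mulr0 !mul0r oppr0 chi0 mulr1 sub0r.
  apply: eq_bigr => s s0; rewrite -mulr_suml sum_char_quad ?mulf_neq0 //.
  congr (_ * chi _ * _); have four0 : 4%:R != 0 :> F.
    by rewrite (natrM F 2 2) mulf_neq0.
  by field; rewrite four0 s0 n0.
apply: le_trans (ler_normB _ _) _.
(* The fiber has at most two points, giving [2 q], and the term [s = 0] gives [q]. *)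
rewrite (_ : 3%:R * q = q * 2%:R + q); last by ring.
apply: lerD.
  rewrite normrM normr_nat ler_wpM2l ?ler0n //.
  apply: le_trans (ler_norm_sum _ _ _) _.
  under eq_bigr do rewrite normr_char.
  rewrite sumr_const ler_nat; apply: leq_trans (card_sqrt (t / n)).
  apply: subset_leq_card; apply/subsetP => y; rewrite !inE => /eqP <-.
  by rewrite mulrAC mulfV ?mul1r.
apply: le_trans (ler_norm_sum _ _ _) _.
by under eq_bigr do rewrite normr_char; rewrite sumr_const cardT.
Qed.

(** For odd [d], [gauss s ^+ d] is a constant of modulus [q ^+ k] times a single [gauss s], which
    leaves a Salie sum of size at most [3 q]. *)
Lemma norm_sphere_hat_odd t x k : d = k.*2.+1 -> x != 0 ->
  `|sphere_hat t x| <= 3%:R * q ^+ k.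
Proof.
move=> dE x0.
(* The Salie bound needs [sqnorm x] in the form [z ^+ 2 / n], and passing from [gauss s] to
   [gauss (n * s)] then costs only the sign [e]. *)
have [n [z [n0 bE]]] : exists n z, n != 0 /\ sqnorm x = z ^+ 2 / n.
  have [b0|b0] := eqVneq (sqnorm x) 0.
    by exists 1, 0; rewrite oner_neq0 expr0n mul0r.
  by exists (sqnorm x)^-1, 1; rewrite invr_eq0 b0 expr1n invrK mul1r.
have [e [e2 gE]] := gauss_mul n0.
have e_norm : `|e| = 1.
  by apply/eqP; rewrite -(pexpr_eq1 (n:=2)) // -normrX e2 normr1.
(* The square of a Gauss sum does not depend on [s], since the sign disappears. *)
have gg s : s != 0 -> gauss s ^+ 2 = gauss 1 ^+ 2.
  move=> s0; have [e' [e'2 g'E]] := gauss_mul s0.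
  by rewrite -[s]mulr1 g'E ?oner_neq0 // exprMn e'2 mul1r.
rewrite -(ler_pM2l q_gt0) -[X in X * `|_|]normr_nat -normrM sphere_hatE (negPf x0) add0r.
have -> : \sum_(s | s != 0) gauss s ^+ d * chi (- (sqnorm x / (4%:R * s))) *
      chi (- (s * t)) = gauss 1 ^+ k.*2 * e * \sum_(s | s != 0)
        gauss (n * s) * chi (- (z ^+ 2 / n / (4%:R * s))) * chi (- (s * t)).
  rewrite mulr_sumr; apply: eq_bigr => s s0; rewrite !mulrA; congr (_ * _ * _).
    rewrite gE // dE exprS -mul2n !exprM gg // mulrACA.
    by rewrite mulrC -[LHS]mul1r -e2 expr2 !mulrA; ring.
  by rewrite bE.
rewrite !normrM e_norm mulr1 normrX -mul2n exprM normr_gauss ?oner_neq0 //.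
rewrite (_ : q * (3%:R * q ^+ k) = q ^+ k * (3%:R * q)); last by ring.
by rewrite ler_wpM2l ?exprn_ge0 ?ler0n // salie_bound.
Qed.

(** * Sizes of spheres *)

Lemma card_ge3 : (3 <= #|F|)%N.
Proof.
have N1 : -1 != 1 :> F.
  by apply: contraNneq two_neq0 => N1; rewrite mulr2n -[X in X + _]N1 addNr.
have <- : #|[set 0; 1; -1 : F]| = 3%N.
  by rewrite setUC cardsU1 cards2 !inE oppr_eq0 oner_eq0 (negPf N1) eq_sym oner_eq0.
exact: max_card.
Qed.

Lemma normr_gaussE s : s != 0 -> `|gauss s| = sqrtC q.
Proof. by move=> s0; rewrite -(normr_gauss s0) sqrCK. Qed.

(** Squared, this is [9 <= 4 q]. It serves to absorb the error term in the point count of a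
    sphere. *)
Lemma sqrt_card_ge : 3%:R <= 2%:R * sqrtC q.
Proof.
rewrite -(ler_pXn2r (n := 2)) ?nnegrE ?mulr_ge0 ?sqrtC_ge0 ?ler0n //.
rewrite exprMn sqrtCK -!natrX -natrM ler_nat.
by apply: leq_trans (leq_mul (leqnn _) card_ge3).
Qed.

(** The size is [sphere_hat t 0], with main term [q ^+ (d - 1)] and an error of at most [r ^+ d],
    from fewer than [q] terms of modulus [r ^+ d] divided by [q]. *)
Lemma card_sphere_ge t : (3 <= d)%N ->
  q ^+ (d - 1) <= 3%:R * #|[pred m : vec F d | sqnorm m == t]|%:R.
Proof.
move=> d_ge3; set N := #|[pred m : vec F d | _]|%:R.
pose r : C := sqrtC q.
have rq : q = r ^+ 2 by rewrite sqrtCK.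
have r_gt0 : 0 < r by rewrite sqrtC_gt0.
have NE : N = sphere_hat t 0.
  rewrite /sphere_hat (eq_bigr (fun _ => 1)) => [|m _].
    by rewrite sumr_const.
  by rewrite /dotp big1 ?oppr0 ?chi0 // => i _; rewrite ffunE mulr0.
have ub : `|q ^+ (d - 1) - N| <= r ^+ d.
  rewrite -(ler_pM2l q_gt0) -[X in X * `|_|]normr_nat -normrM mulrBr NE.
  rewrite sphere_hatE eqxx -exprS -[(d - 1).+1]addn1 subnK ?(leq_trans _ d_ge3) //.
  rewrite opprD addNKr normrN.
  apply: le_trans (ler_norm_sum _ _ _) _.
  rewrite (eq_bigr (fun=> r ^+ d)) => [|s s0]; last first.
    by rewrite !normrM !normr_char !mulr1 normrX normr_gaussE.
  rewrite sumr_const -[X in X <= _]mulr_natl ler_wpM2r ?exprn_ge0 ?ler_nat ?max_card //.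
  exact: ltW.
have lb : q ^+ (d - 1) - r ^+ d <= N.
  rewrite lerBlDr -lerBlDl; apply: le_trans ub; apply: real_ler_norm.
  by rewrite rpredB ?rpredX ?realn.
(* The error is at most two thirds of the main term: the quotient [r ^+ (d - 2)] is at least [r], as
   [d >= 3], and [r >= 3/2]. *)
have h : 3%:R * r ^+ d <= 2%:R * q ^+ (d - 1).
  rewrite rq -exprM (_ : (2 * (d - 1) = d + (d - 3).+1)%N); last by lia.
  rewrite exprD exprS [3%:R * _]mulrC mulrCA ler_pM2l ?exprn_gt0 //.
  rewrite mulrA -[X in X <= _]mulr1 ler_pM ?ler01 ?ler0n ?sqrt_card_ge //.
  rewrite exprn_ege1 // -(ler_pM2l (x := 2%:R)) ?ltr0n // mulr1.
  by apply: le_trans sqrt_card_ge; rewrite ler_nat.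
rewrite -(lerD2r (- (3%:R * r ^+ d))).
apply: le_trans (_ : 3%:R * (q ^+ (d - 1) - r ^+ d) - 2%:R * q ^+ (d - 1) <= _).
  by rewrite le_eqVlt; apply/orP; left; apply/eqP; ring.
by apply: lerB => //; rewrite ler_pM2l ?ltr0n.
Qed.

(** This passes from a sum over radii to a sum over vectors, where the norm of a radial function
    lives. *)
Lemma sum_spheres_le (w : F -> C) : (3 <= d)%N -> (forall t, 0 <= w t) ->
  q ^+ (d - 1) * \sum_t w t <= 3%:R * \sum_(m : vec F d) w (sqnorm m).
Proof.
move=> d_ge3 w0; rewrite mulr_sumr.
rewrite [X in _ <= _ * X](partition_big (@sqnorm F d) xpredT) //= mulr_sumr.
apply: ler_sum => t _; rewrite (eq_bigr (fun=> w t)) => [|m /eqP -> //].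
by rewrite sumr_const -[X in _ <= _ * X]mulr_natl mulrA ler_wpM2r // card_sphere_ge.
Qed.

(** * Transforms of radial functions off the origin *)

Lemma char_parseval (a : F -> C) :
  \sum_t `|\sum_s a s * chi (- (s * t))| ^+ 2 = q * \sum_s `|a s| ^+ 2.
Proof.
under eq_bigr => t _.
  rewrite normCK rmorph_sum /= big_distrlr /=.
  under eq_bigr => s _ do under eq_bigr => s' _ do
    rewrite rmorphM /= -charN opprK mulrACA -chiD [- _ + _]addrC -mulrBl.
  over.
rewrite exchange_big mulr_sumr /=; apply: eq_bigr => s _.
rewrite exchange_big (bigD1 s) //= -mulr_sumr sum_char subrr eqxx big1 => [|s' s's].
  by rewrite addr0 normCK mulrC.
by rewrite -mulr_sumr sum_char subr_eq0 (negPf s's) mulr0.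
Qed.

Lemma sum_sphere_hat_sqr x : x != 0 ->
  \sum_t `|sphere_hat t x| ^+ 2 <= q ^+ d.
Proof.
move=> x0; rewrite -(ler_pM2l (exprn_gt0 2 q_gt0)) mulr_sumr.
(* For fixed [x], [q * sphere_hat t x] is a one-dimensional transform in [t]; its coefficients are
   extended by zero to [s = 0] and have modulus squared at most [q ^+ d]. *)
pose a s := if s == 0 then 0 else gauss s ^+ d * chi (- (sqnorm x / (4%:R * s))).
rewrite (eq_bigr (fun t => `|\sum_s a s * chi (- (s * t))| ^+ 2)) => [|t _]; last first.
  rewrite -exprMn -[X in X * `|_|]normr_nat -normrM sphere_hatE (negPf x0) add0r.
  rewrite [in RHS](bigD1 0) //= /a eqxx mul0r add0r.
  by congr (`|_| ^+ 2); apply: eq_bigr => s /negPf ->.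
rewrite char_parseval expr2 -mulrA ler_pM2l //.
apply: le_trans (ler_sum _ (_ : forall s, _ -> _ <= q ^+ d)) _.
  move=> s _; rewrite /a; case: eqVneq => [_|s0].
    by rewrite normr0 expr0n exprn_ge0 // ltW.
  by rewrite normrM normr_char mulr1 normrX exprAC normr_gauss.
by rewrite sumr_const mulr_natl cardT.
Qed.

Lemma radial_fourierE (w : F -> C) x :
  \sum_m chi (- dotp m x) * w (sqnorm m) = \sum_t w t * sphere_hat t x.
Proof.
rewrite (partition_big (@sqnorm F d) xpredT) //=; apply: eq_bigr => t _.
by rewrite mulr_sumr; apply: eq_bigr => m /eqP ->; rewrite mulrC.
Qed.

Lemma radial_fourier_sqr (w : F -> C) x : x != 0 ->
  `|\sum_m chi (- dotp m x) * w (sqnorm m)| ^+ 2 <= q ^+ d * \sum_t `|w t| ^+ 2.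
Proof.
move=> x0; rewrite radial_fourierE.
apply: le_trans (_ : (\sum_t `|w t| * `|sphere_hat t x|) ^+ 2 <= _).
  rewrite ler_pXn2r ?nnegrE ?sumr_ge0 // => [|t _]; last exact: mulr_ge0.
  by apply: le_trans (ler_norm_sum _ _ _) _; under eq_bigr do rewrite normrM.
apply: le_trans (cauchy_schwarz_sum _ _) _ => //.
by rewrite mulrC ler_wpM2r ?sumr_ge0 ?sum_sphere_hat_sqr // => t _; rewrite exprn_ge0.
Qed.

(** One factor 3 comes from the transform of each sphere and one from its size; [d - 1 = 2 k] leaves
    the gain [q ^+ k]. *)
Lemma radial_fourier_odd (w : F -> C) x k :
  d = k.*2.+1 -> (3 <= d)%N -> x != 0 ->
  q ^+ k * `|\sum_m chi (- dotp m x) * w (sqnorm m)| <=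
    9%:R * \sum_(m : vec F d) `|w (sqnorm m)|.
Proof.
move=> dE d_ge3 x0; rewrite radial_fourierE.
apply: le_trans (_ : 3%:R * (q ^+ (d - 1) * \sum_t `|w t|) <= _); last first.
  by rewrite (natrM C 3 3) -mulrA ler_pM2l ?ltr0n // sum_spheres_le.
have -> : (d - 1 = k + k)%N by rewrite dE subn1 addnn.
rewrite exprD -mulrA mulrCA ler_pM2l ?exprn_gt0 //.
rewrite mulrA mulr_sumr; apply: le_trans (ler_norm_sum _ _ _) _.
apply: ler_sum => t _; rewrite normrM mulrC ler_wpM2r //.
exact: norm_sphere_hat_odd.
Qed.

End GaussSums.

(** * Real powers and inequalities between power sums *)

Lemma rpow_ge0 (x y : R) : 0 <= rpow x y.
Proof.
rewrite /rpow; case: (Rlt_dec R0 x) => [x0|_] //=.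
by apply/ltW/RltP; apply: exp_pos.
Qed.

Lemma rpow_gt0E (x y : R) : 0 < x -> rpow x y = Rpower x y.
Proof. by move=> /RltP x0; rewrite /rpow; case: (Rlt_dec R0 x). Qed.

Lemma rpow_gt0 (x y : R) : 0 < x -> 0 < rpow x y.
Proof. by move=> x0; rewrite rpow_gt0E //; apply/RltP; apply: exp_pos. Qed.

Lemma rpow_le0E (x y : R) : x <= 0 -> rpow x y = 0.
Proof. by rewrite leNgt /rpow; case: (Rlt_dec R0 x) => [/= /RltP ->|]. Qed.

Lemma rpow0 (y : R) : rpow 0 y = 0.
Proof. exact: rpow_le0E. Qed.

Lemma rpowM (x y a : R) : 0 <= x -> 0 <= y -> rpow (x * y) a = rpow x a * rpow y a.
Proof.
rewrite !le_eqVlt => /predU1P[<- _|x0]; first by rewrite !(mul0r, rpow0).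
case/predU1P => [<-|y0]; first by rewrite !(mulr0, rpow0).
by rewrite !rpow_gt0E ?mulr_gt0 //; apply/esym/Rpower_mult_distr; apply/RltP.
Qed.

Lemma rpow_rpow (x a b : R) : rpow (rpow x a) b = rpow x (a * b).
Proof.
have [x0|x0] := ltrP 0 x; last by rewrite !(rpow_le0E _ x0) rpow0.
by rewrite (rpow_gt0E b (rpow_gt0 a x0)) !(rpow_gt0E _ x0); apply: Rpower_mult.
Qed.

Lemma rpowD (x a b : R) : 0 < x -> rpow x (a + b) = rpow x a * rpow x b.
Proof. by move=> x0; rewrite !rpow_gt0E //; apply: Rpower_plus. Qed.

Lemma ler_rpow (a x y : R) : 0 < a -> x <= y -> rpow x a <= rpow y a.
Proof.
move=> a0 xy; have [x0|x0] := ltrP 0 x; last by rewrite (rpow_le0E _ x0) rpow_ge0.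
rewrite !rpow_gt0E ?(lt_le_trans x0) //; apply/RleP; apply: Rle_Rpower_l.
  exact/RleP/ltW.
by split; [apply/RltP | apply/RleP].
Qed.

(** The exponent 0 is excluded because [rpow 0 0 = 0] whereas [0 ^+ 0 = 1]. *)
Lemma rpow_nat (x : R) (n : nat) : (0 < n)%N -> 0 <= x -> rpow x n%:R = x ^+ n.
Proof.
move=> n0; rewrite le_eqVlt => /predU1P[<-|x0].
  by rewrite rpow0 expr0n -[n]prednK.
by rewrite rpow_gt0E // -INRE Rpower_pow ?RpowE //; apply/RltP.
Qed.

Lemma rpow1 (x : R) : 0 <= x -> rpow x 1 = x.
Proof. by move=> x0; rewrite -[1]/(1%:R) rpow_nat. Qed.

(* Convexity of [exp], through its tangent at [ln x]. *)
Lemma rpow_young (x p : R) : 0 <= x -> 1 < p -> x <= p^-1 * rpow x p + (1 - p^-1).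
Proof.
move=> x_ge0 p1; have p0 : 0 < p by apply: lt_trans p1.
move: x_ge0; rewrite le_eqVlt => /predU1P[<-|x0].
  by rewrite rpow0 mulr0 add0r subr_ge0 invf_le1 // ltW.
rewrite rpow_gt0E // /Rpower.
have xE : exp (ln x) = x by apply: exp_ln; apply/RltP.
move: (ln x) xE => u xE.
have tangent v : x * (1 + (v - u)) <= exp v.
  have -> : exp v = x * exp (v - u) by rewrite -xE expRD RplusE addrC subrK.
  by rewrite ler_pM2l //; apply/RleP; apply: exp_ineq1_le.
(* The points [p * u] and [0] with weights [p^-1] and [1 - p^-1] average to [u], so the linear terms
   cancel. *)
have t1 := tangent (p * u); have t2 := tangent 0.
rewrite exp_0 in t2; change (p * u) with (Rmult p u) in *.
have pi0 : 0 <= p^-1 by rewrite invr_ge0 ltW.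
have pi1 : 0 <= 1 - p^-1 by rewrite subr_ge0 invf_le1 // ltW.
have := lerD (ler_wpM2l pi0 t1) (ler_wpM2l pi1 t2); rewrite mulr1; apply: le_trans.
by rewrite le_eqVlt RmultE; apply/orP; left; apply/eqP; field; rewrite gt_eqF.
Qed.

Lemma rpow_eq0 (x y : R) : 0 <= x -> rpow x y = 0 -> x = 0.
Proof.
rewrite le_eqVlt => /predU1P[//|x0 /eqP].
by rewrite gt_eqF ?rpow_gt0.
Qed.

(** Hoelder's inequality against the constant 1, by summing Young's inequality for the normalized
    values [a i / M]. *)
Lemma sum_le_rpow (I : finType) (a : I -> R) (p : R) :
  1 < p -> (forall i, 0 <= a i) ->
  \sum_i a i <= rpow #|I|%:R (1 - p^-1) * rpow (\sum_i rpow (a i) p) p^-1.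
Proof.
move=> p1 a0; have p0 : 0 < p by apply: lt_trans p1.
have pne0 : p != 0 by rewrite gt_eqF.
set S := \sum_i rpow (a i) p.
have : 0 <= S by apply: sumr_ge0 => i _; apply: rpow_ge0.
rewrite le_eqVlt => /predU1P[S0|S_gt0].
  rewrite big1 ?mulr_ge0 ?rpow_ge0 // => i _; apply: (rpow_eq0 (a0 i) (y := p)).
  exact: (psumr_eq0P (fun j _ => rpow_ge0 (a j) p) (esym S0)).
have N_gt0 : 0 < #|I|%:R :> R.
  rewrite ltr0n; apply/card_gt0P; have [i _ //|I0] := pickP (mem I); first by exists i.
  by move: S_gt0; rewrite /S big1 ?ltxx // => i; have := I0 i.
set N := #|I|%:R in N_gt0 *.
(* The [p]-mean of [a]: after division by it the [p]-th powers sum to [N], so the Young bounds add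
   up to exactly [N]. *)
set M := rpow (S / N) p^-1.
have SN_gt0 : 0 < S / N by rewrite divr_gt0.
have M_gt0 : 0 < M by apply: rpow_gt0.
have Mp : rpow M p = S / N by rewrite rpow_rpow mulVf // rpow1 // ltW.
have -> : rpow S p^-1 = rpow N p^-1 * M.
  by rewrite -rpowM ?ltW // mulrCA divff ?mulr1 // gt_eqF.
rewrite mulrA -rpowD // subrK (rpow1 (ltW N_gt0)) -ler_pdivrMr // mulr_suml.
have y_ge0 i : 0 <= a i / M by rewrite divr_ge0 ?a0 ?ltW.
apply: le_trans (ler_sum _ (fun i _ => rpow_young (y_ge0 i) p1)) _.
rewrite big_split /= -mulr_sumr sumr_const -[(1 - _) *+ _]mulr_natr -/N.
have -> : \sum_i rpow (a i / M) p = N.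
  apply: (mulIf (x := S / N)); first by rewrite gt_eqF.
  rewrite mulr_suml (eq_bigr (fun i => rpow (a i) p)) => [|i _].
    by rewrite mulrCA divff ?mulr1 // gt_eqF.
  by rewrite -Mp -(rpowM _ (y_ge0 i) (ltW M_gt0)) divfK // gt_eqF.
by rewrite -mulrDl addrC subrK mul1r.
Qed.

(** Each [b i] is at most the total [B], hence [(b i)^s <= b i * B^(s-1)]. *)
Lemma sum_rpow_le (I : finType) (b : I -> R) (s : R) :
  1 < s -> (forall i, 0 <= b i) -> \sum_i rpow (b i) s <= rpow (\sum_i b i) s.
Proof.
move=> s1 b0; set B := \sum_i b i.
have leB i : b i <= B by rewrite /B (bigD1 i) //= lerDl sumr_ge0.
have : 0 <= B by apply: sumr_ge0.
rewrite le_eqVlt => /predU1P[B0|B_gt0].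
  by rewrite -B0 rpow0 big1 // => i _; rewrite rpow_le0E // B0.
rewrite -{2}[s](subrK 1) addrC rpowD // (rpow1 (ltW B_gt0)) /B mulr_suml -/B.
apply: ler_sum => i _; have := b0 i; rewrite le_eqVlt => /predU1P[<-|bi_gt0].
  by rewrite rpow0 mul0r.
rewrite -{1}[s](subrK 1) addrC rpowD // (rpow1 (ltW bi_gt0)).
by rewrite ler_pM2l // ler_rpow // subr_gt0.
Qed.

(** * Transfer between pairs of reals and the field [R[i]] *)

Definition toC (z : Cpx) : R[i] := Complex z.1 z.2.

Lemma toC_add z w : toC (Cadd z w) = toC z + toC w. Proof. by []. Qed.

Lemma toC_sum (I : finType) (P : pred I) (h : I -> Cpx) :
  toC (\big[Cadd/C0]_(i | P i) h i) = \sum_(i | P i) toC (h i).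
Proof. exact: (big_morph toC toC_add (erefl _)). Qed.

Lemma toC_inj : injective toC.
Proof. by move=> [a b] [a' b'] [-> ->]. Qed.

Lemma norm_toC z : `|toC z| = (Cmod z)%:C%C.
Proof. by rewrite normc_def /Cmod RsqrtE !expr2. Qed.

Lemma Cmod_ge0 z : 0 <= Cmod z.
Proof. by rewrite /Cmod RsqrtE sqrtr_ge0. Qed.

Local Open Scope complex_scope.

(** The equation [chi 0 = chi 0 * chi 0] leaves [chi 0 = 0] or [chi 0 = 1]. The first makes [chi]
    vanish identically, which the definition of a nontrivial character admits. *)
Lemma additive_char_cases (F : finFieldType) (chi : F -> Cpx) :
  nontrivial_additive_char chi ->
  (forall a, chi a = C0) \/
  [/\ forall a b, toC (chi (a + b)) = toC (chi a) * toC (chi b),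
      toC (chi 0) = 1 & exists a, toC (chi a) != 1].
Proof.
move=> [chiD [a chia]]; have mulD b c : toC (chi (b + c)) = toC (chi b) * toC (chi c).
  by rewrite chiD.
have := mulD 0 0; rewrite addr0 => /esym/eqP; rewrite -subr_eq0 -{3}[toC _]mulr1.
rewrite -mulrBr mulf_eq0 subr_eq0 => /orP[/eqP chi0|/eqP chi0].
  by left=> b; apply: toC_inj; rewrite -[b]addr0 mulD chi0 mulr0.
right; split=> //; exists a; apply/eqP => chia1; apply: chia.
exact: toC_inj.
Qed.

Lemma radial_profile (F : finFieldType) (d : nat) (f : vec F d -> Cpx) :
  radial f -> exists w : F -> Cpx, forall m, f m = w (sqnorm m).
Proof.
(* The default [C0] is the value at radii that no vector attains. *)
move=> rad; exists (fun t => if [pick m | sqnorm m == t] is Some m then f m else C0).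
move=> m; case: pickP => [n /eqP/rad //|/(_ m)].
by rewrite eqxx.
Qed.

Section RealBounds.

Variables (F : finFieldType) (chi : F -> Cpx) (d : nat).
Hypothesis two_neq0 : 2%:R != 0 :> F.
Hypothesis chiD : forall a b, toC (chi (a + b)) = toC (chi a) * toC (chi b).
Hypothesis chi0 : toC (chi 0) = 1.
Hypothesis chi_nontrivial : exists a, toC (chi a) != 1.

Local Notation q := (#|F|%:R : R).

Lemma toC_fourier (f : vec F d -> Cpx) x :
  toC (fourier chi f x) = \sum_m toC (chi (- dotp m x)) * toC (f m).
Proof. exact: toC_sum. Qed.

Lemma toC_fourier_radial (f : vec F d -> Cpx) (w : F -> Cpx) x :
  (forall m, f m = w (sqnorm m)) ->
  toC (fourier chi f x) = \sum_m toC (chi (- dotp m x)) * toC (w (sqnorm m)).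
Proof. by move=> fE; rewrite toC_fourier; apply: eq_bigr => m _; rewrite fE. Qed.

Lemma Cmod_fourier_le (f : vec F d -> Cpx) x :
  Cmod (fourier chi f x) <= \sum_m Cmod (f m).
Proof.
rewrite -lecR -norm_toC toC_fourier rmorph_sum /=.
apply: le_trans (ler_norm_sum _ _ _) _; apply: ler_sum => m _.
by rewrite normrM (normr_char chiD chi0) mul1r norm_toC.
Qed.

Lemma sum_spheres_leR (w : F -> R) : (3 <= d)%N -> (forall t, 0 <= w t) ->
  q ^+ (d - 1) * \sum_t w t <= 3%:R * \sum_(m : vec F d) w (sqnorm m).
Proof.
move=> d_ge3 w0; rewrite -lecR !rmorphM rmorphXn !rmorph_sum !rmorph_nat /=.
apply: (sum_spheres_le two_neq0 chiD chi0 chi_nontrivial (w := fun t => (w t)%:C)) => // t.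
by rewrite ler0c.
Qed.

Lemma Cmod_fourier_sqr (f : vec F d -> Cpx) (w : F -> Cpx) x :
  (forall m, f m = w (sqnorm m)) -> x != 0 ->
  Cmod (fourier chi f x) ^+ 2 <= q ^+ d * \sum_t Cmod (w t) ^+ 2.
Proof.
move=> fE x0; rewrite -lecR rmorphXn rmorphM rmorphXn rmorph_sum rmorph_nat /=.
rewrite -norm_toC (toC_fourier_radial _ fE).
under [X in _ <= _ * X]eq_bigr do rewrite rmorphXn /= -norm_toC.
exact: (radial_fourier_sqr two_neq0 chiD chi0 chi_nontrivial (fun t => toC (w t))).
Qed.

Lemma Cmod_fourier_odd (f : vec F d -> Cpx) x k :
  radial f -> d = k.*2.+1 -> (3 <= d)%N -> x != 0 ->
  q ^+ k * Cmod (fourier chi f x) <= 9%:R * \sum_m Cmod (f m).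
Proof.
move=> /radial_profile[w fE] dE d_ge3 x0.
rewrite -lecR !rmorphM rmorphXn rmorph_sum !rmorph_nat /=.
rewrite -norm_toC (toC_fourier_radial _ fE).
under [X in _ <= _ * X]eq_bigr do rewrite -norm_toC fE.
exact: (radial_fourier_odd two_neq0 chiD chi0 chi_nontrivial (fun t => toC (w t)) dE).
Qed.

End RealBounds.

(** * Norms, the mass at the origin and the choice of exponents *)

Lemma Lp_normE (F : finFieldType) (d : nat) (p : R) (f : vec F d -> Cpx) :
  Lp_norm p f = rpow (\sum_m rpow (Cmod (f m)) p) p^-1.
Proof. by []. Qed.

Lemma Lsigma_normE (F : finFieldType) (d : nat) (r : R) (V : {set vec F d})
    (g : vec F d -> Cpx) :
  Lsigma_norm r V g = rpow (#|V|%:R^-1 * \sum_(x in V) rpow (Cmod (g x)) r) r^-1.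
Proof. by rewrite /Lsigma_norm INRE. Qed.

(* The frequency [0] has mass [1 / |V|], which absorbs the factor [q ^ (d - 1)]. *)
Lemma Lsigma_norm_le (F : finFieldType) (d : nat) (V : {set vec F d})
    (c r A K : R) (g : vec F d -> Cpx) :
  0 < c -> 0 < r -> 0 <= A -> 0 <= K ->
  c * #|F|%:R ^+ (d - 1) <= #|V|%:R ->
  (forall x, x != 0 -> Cmod (g x) <= K * A) ->
  rpow (Cmod (g 0)) r <= #|F|%:R ^+ (d - 1) * rpow A r ->
  Lsigma_norm r V g <= rpow (c^-1 + rpow K r) r^-1 * A.
Proof.
move=> c0 r0 A0 K0 Vge gx g0; rewrite Lsigma_normE.
set Q := _ ^+ (d - 1) in Vge g0.
have Q0 : 0 < Q by rewrite exprn_gt0 // ltr0n; apply/card_gt0P; exists 0.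
have V0 : 0 < #|V|%:R :> R by apply: lt_le_trans Vge; rewrite mulr_gt0.
have ci0 : 0 <= c^-1 by rewrite invr_ge0 ltW.
have AE : A = rpow (rpow A r) r^-1 by rewrite rpow_rpow divff ?rpow1 // gt_eqF.
rewrite {1}AE -rpowM ?addr_ge0 ?rpow_ge0 //.
apply: ler_rpow; first by rewrite invr_gt0.
rewrite mulrC ler_pdivrMr //.
(* Only the term at [x = 0] carries the large factor [Q]; all others are bounded by [(K * A)^r]. *)
apply: le_trans (_ : \sum_(x in V) ((x == 0)%:R * (Q * rpow A r) + rpow K r * rpow A r) <= _).
  apply: ler_sum => x _; case: eqVneq => [->|x0].
    by rewrite mul1r (le_trans g0) // lerDl mulr_ge0 ?rpow_ge0.
  by rewrite mul0r add0r -rpowM // ler_rpow // gx.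
rewrite big_split /= sumr_const -mulr_suml -[X in _ + X]mulr_natr mulrDl mulrDl.
rewrite lerD2r [X in _ <= X]mulrAC [Q * _]mulrC mulrA -!mulrA.
rewrite [X in X <= _](_ : _ = rpow A r * (Q * \sum_(x in V) (x == 0)%:R)); last by ring.
rewrite [X in _ <= X](_ : _ = rpow A r * (c^-1 * #|V|%:R)); last by ring.
apply: ler_wpM2l; first exact: rpow_ge0.
(* The remaining sum is 1 or 0 according to whether [0] lies in [V], and [Q <= c^-1 * #|V|] is the
   lower bound on [V]. *)
apply: le_trans (_ : Q * 1 <= _); last first.
  by rewrite mulr1 mulrC ler_pdivlMr // mulrC.
rewrite ler_pM2l //.
have [V00|V00] := boolP (0 \in V).
  by rewrite (bigD1 (0 : vec F d)) //= eqxx big1 ?addr0 // => x /andP[_ /negPf ->].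
by rewrite big1 ?ler01 // => x xV; case: eqVneq => // x0; rewrite -x0 xV in V00.
Qed.

Lemma sum_le_Lp_norm (F : finFieldType) (d : nat) (p : R) (f : vec F d -> Cpx) :
  (0 < d)%N -> 1 < p ->
  \sum_m Cmod (f m) <= rpow #|F|%:R (d%:R * (1 - p^-1)) * Lp_norm p f.
Proof.
move=> d_gt0 p1; rewrite Lp_normE -rpow_rpow rpow_nat ?ler0n //.
apply: le_trans (sum_le_rpow p1 (fun m => Cmod_ge0 (f m))) _.
by rewrite card_ffun card_ord natrX.
Qed.

Lemma fourier_zero_char (F : finFieldType) (chi : F -> Cpx) (d : nat)
    (f : vec F d -> Cpx) x :
  (forall a, chi a = C0) -> Cmod (fourier chi f x) = 0.
Proof.
move=> chi0; apply: complexI; rewrite -norm_toC toC_fourier big1 ?normr0 // => m _.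
by rewrite chi0 mul0r.
Qed.

(** The estimate off the origin, free of [V] and [r]: the odd and even cases differ in how it is
    obtained and then share one reduction. *)
Definition pointwise_bounded (d : nat) (p K : R) : Prop :=
  forall (F : finFieldType) (chi : F -> Cpx) (f : vec F d -> Cpx) (x : vec F d),
    2%:R != 0 :> F ->
    (forall a b, toC (chi (a + b)) = toC (chi a) * toC (chi b)) ->
    toC (chi 0) = 1 -> (exists a, toC (chi a) != 1) ->
    radial f -> x != 0 -> Cmod (fourier chi f x) <= K * Lp_norm p f.

(** At the origin Hoelder's inequality costs [q^(d (1 - 1/p))]; the relation between [p] and [r]
    says that its [r]-th power is exactly [q^(d - 1)]. *)
Lemma Rrad_bounded_of_pointwise (d : nat) (c C p r K : R) :
  (1 < d)%N -> 0 < c -> 1 < p -> 0 < r -> 0 <= K ->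
  d%:R * (1 - p^-1) * r = (d - 1)%N%:R ->
  pointwise_bounded d p K -> Rrad_bounded d c C p r.
Proof.
move=> d1 c0 p1 r0 K0 dpr fx.
exists (rpow (c^-1 + rpow K r) r^-1) => F F2 V _ Vge _ chi chi_char f rad.
have two_neq0 : 2%:R != 0 :> F by move: F2; rewrite inE.
have A0 : 0 <= Lp_norm p f by apply: rpow_ge0.
have q0 : 0 <= #|F|%:R :> R by rewrite ler0n.
apply/RleP; apply: Lsigma_norm_le => // [|x x0|].
- by move/RleP: Vge; rewrite !INRE RpowE.
- have [chi0|[chiD chi0 chi_nt]] := additive_char_cases chi_char; last exact: fx.
  by rewrite fourier_zero_char // mulr_ge0.
- have [chi0|[chiD chi0 chi_nt]] := additive_char_cases chi_char.
    by rewrite fourier_zero_char // rpow0 mulr_ge0 ?exprn_ge0 ?rpow_ge0.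
  apply: le_trans (ler_rpow r0 (le_trans (Cmod_fourier_le chiD chi0 f 0)
    (sum_le_Lp_norm f (ltnW d1) p1))) _.
  by rewrite rpowM ?rpow_ge0 // rpow_rpow dpr rpow_nat // subn_gt0.
Qed.

(** The Hoelder loss [q^(d (1 - 1/p)) = q^k] cancels the gain [q^k] in the transform. *)
Lemma pointwise_bounded_odd (d k : nat) (p : R) :
  (3 <= d)%N -> d = k.*2.+1 -> 1 < p -> d%:R * (1 - p^-1) = k%:R ->
  pointwise_bounded d p 9%:R.
Proof.
move=> d3 dE p1 dp F chi f x two_neq0 chiD chi0 chi_nt rad x0.
have k_gt0 : (0 < k)%N by lia.
have q_gt0 : (0 : R) < #|F|%:R ^+ k.
  by rewrite exprn_gt0 // ltr0n; apply/card_gt0P; exists 0.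
rewrite -(ler_pM2l q_gt0).
apply: le_trans (Cmod_fourier_odd two_neq0 chiD chi0 chi_nt rad dE d3 x0) _.
rewrite mulrCA ler_pM2l ?ltr0n //.
by apply: le_trans (sum_le_Lp_norm f (ltnW (ltnW d3)) p1) _; rewrite dp rpow_nat ?ler0n.
Qed.

Lemma pointwise_bounded_sqr (d : nat) (p : R) :
  (3 <= d)%N -> 0 < p < 2%:R -> (d - 1)%N%:R * (2%:R / p) = d%:R ->
  pointwise_bounded d p (rpow 3%:R p^-1).
Proof.
move=> d3 /andP[p0 p2] dp F chi f x two_neq0 chiD chi0 chi_nt rad x0.
have [w fE] := radial_profile rad.
have q_gt0 : (0 : R) < #|F|%:R by rewrite ltr0n; apply/card_gt0P; exists 0.
have s1 : 1 < 2%:R / p by rewrite ltr_pdivlMr // mul1r.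
rewrite Lp_normE -rpowM ?ler0n //; last by apply: sumr_ge0 => m _; apply: rpow_ge0.
set S := \sum_m _.
rewrite -(ler_pXn2r (n := 2)) ?nnegrE ?Cmod_ge0 ?rpow_ge0 //.
apply: le_trans (Cmod_fourier_sqr two_neq0 chiD chi0 chi_nt fE x0) _.
pose W := \sum_t rpow (Cmod (w t)) p.
have W_ge0 : 0 <= W by apply: sumr_ge0 => t _; apply: rpow_ge0.
(* The embedding of [l^p] in [l^2], applied to the values [|w t|^p] with exponent [2 / p > 1]. *)
have sqrW : \sum_t Cmod (w t) ^+ 2 <= rpow W (2%:R / p).
  apply: le_trans (sum_rpow_le s1 (fun t => rpow_ge0 (Cmod (w t)) p)).
  apply: ler_sum => t _; rewrite rpow_rpow mulrC divfK ?gt_eqF //.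
  by rewrite rpow_nat ?Cmod_ge0.
apply: le_trans (ler_wpM2l _ sqrW) _; first by rewrite exprn_ge0 // ltW.
(* By [dp], [q^d] is the [2 / p]-th power of [q^(d - 1)], so both factors merge into
   [(q^(d - 1) * W)^(2 / p)], and the sizes of spheres bound the base by [3 * S]. *)
rewrite -[X in X * _](rpow_nat (n := d)) ?ler0n ?(leq_trans _ d3) // -dp -rpow_rpow.
rewrite rpow_nat ?ler0n //; last by lia.
rewrite -rpowM ?exprn_ge0 ?ler0n // -[X in _ <= X]rpow_nat ?rpow_ge0 //.
rewrite rpow_rpow [p^-1 * _]mulrC ler_rpow ?(lt_trans _ s1) //.
have := sum_spheres_leR two_neq0 chiD chi0 chi_nt d3 (fun t => rpow_ge0 (Cmod (w t)) p).
by rewrite (eq_bigr (fun m => rpow (Cmod (f m)) p)) => // m _; rewrite fE.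
Qed.

(** With [d = 2 k + 1] this [p] gives [d (1 - 1/p) = k], and [r = 2] turns it into [d - 1]. *)
Lemma Rrad_bounded_odd (c C : R) (d : nat) : 0 < c -> (3 <= d)%N -> odd d ->
  Rrad_bounded d c C ((2 * d)%N%:R / (d + 1)%N%:R) 2%:R.
Proof.
move=> c0 d_ge d_odd.
have dE : d = d./2.*2.+1 by rewrite -[LHS]odd_double_half d_odd.
have k_gt0 : (0 < d./2)%N by lia.
move: (d./2) dE k_gt0 => k dE k_gt0.
have kE : d%:R = 2%:R * k%:R + 1 :> R by rewrite dE -addn1 natrD -mul2n natrM.
have k1 : 1 <= k%:R :> R by rewrite ler1n.
have -> : (2 * d)%N%:R / (d + 1)%N%:R = 2%:R * (2%:R * k%:R + 1) / (2%:R * k%:R + 2%:R) :> R.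
  by rewrite natrM natrD kE -addrA.
set p := _ / _.
have dp : d%:R * (1 - p^-1) = k%:R :> R.
  by rewrite kE /p; field; apply/andP; split; apply: lt0r_neq0; lra.
have p1 : 1 < p by rewrite /p ltr_pdivlMr; lra.
apply: (@Rrad_bounded_of_pointwise d c C p 2%:R 9%:R) => //.
- exact: ltnW.
- by rewrite dp dE subn1 -mul2n natrM mulrC.
- exact: (pointwise_bounded_odd d_ge dE).
Qed.

(** Here [p] solves [(d - 1) * 2 / p = d], as the square bound requires, and [r] then solves
    [d (1 - 1/p) r = d - 1]. *)
Lemma Rrad_bounded_even (c C : R) (d : nat) : 0 < c -> (4 <= d)%N ->
  Rrad_bounded d c C ((2 * d - 2)%N%:R / d%:R)
    ((2 * ((d - 1) * (d - 1)))%N%:R / (d * d - 2 * d)%N%:R).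
Proof.
move=> c0 d_ge; have d_gt1 : (1 < d)%N by apply: leq_trans d_ge.
have D4 : 4%:R <= d%:R :> R by rewrite ler_nat.
(* Subtraction in [nat] is truncated; the size of [d] makes each one here agree with real
   subtraction. *)
have d1E : (d - 1)%N%:R = d%:R - 1 :> R by rewrite natrB // ltnW.
have -> : (2 * d - 2)%N%:R = 2%:R * (d%:R - 1) :> R.
  by rewrite -d1E -natrM mulnBr.
have -> : (d * d - 2 * d)%N%:R = d%:R * (d%:R - 2%:R) :> R.
  by rewrite -mulnBl natrM natrB // mulrC.
rewrite !natrM d1E; set p := _ / d%:R; set r := _ / _.
have p_bounds : 1 < p < 2%:R.
  by rewrite /p ltr_pdivlMr ?ltr_pdivrMr; [apply/andP; split|..]; lra.
have [p1 p2] := andP p_bounds.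
have r0 : 0 < r by rewrite divr_gt0 ?mulr_gt0 //; lra.
have dp : (d - 1)%N%:R * (2%:R / p) = d%:R :> R.
  by rewrite d1E /p; field; apply/andP; split; apply: lt0r_neq0; lra.
apply: (Rrad_bounded_of_pointwise C d_gt1 c0 p1 r0 (rpow_ge0 3%:R p^-1)).
  rewrite d1E /p /r; field.
  by apply/and3P; split; apply: lt0r_neq0; lra.
by apply: (pointwise_bounded_sqr (ltnW d_ge) _ dp); rewrite p2 (lt_trans _ p1).
Qed.

Local Close Scope complex_scope.
Local Close Scope ring_scope.
(* Makes [^] on [nat] denote [Nat.pow], not [expn], in the statement below. *)
From Stdlib Require Import Reals.

Theorem theorem2 :
  forall (c C : R), Rlt R0 c -> Rlt R0 C ->
  (forall d : nat, (3 <= d)%N -> odd d ->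
     Rrad_bounded d c C (Rdiv (INR (2 * d)) (INR (d + 1))) (INR 2)) /\
  (forall d : nat, (4 <= d)%N -> ~~ odd d ->
     Rrad_bounded d c C (Rdiv (INR (2 * d - 2)) (INR d))
       (Rdiv (INR (2 * (d - 1) ^ 2)) (INR (d ^ 2 - 2 * d)))).
Proof.
move=> c C /RltP c0 _; split=> d d_ge d_par; rewrite !RdivE !INRE.
  exact: Rrad_bounded_odd.
rewrite !Nat.pow_2_r; exact: Rrad_bounded_even.
Qed.
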